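(* Let $G,H$ be finite simple connected graphs, fix a root $(r_G,r_H)\in V(G\,\square\,H)$, let $K\in\{G,H\}$ with $\bar K$ the other graph, let $v\in V(\bar K)$, and let $S\subseteq\{w\in V(\bar K): w\sim_{\bar K} v\}$ with $1\le |S|\le \pi(\bar K)-3$. Then every configuration $c$ on $G\,\square\,H$ from which no sequence of pebbling moves places a pebble on $(r_G,r_H)$ satisfies \[ \tilde c_{K,v}+1\ \le\ 2\sum_{j\in S}\bigl(\pi(K)-extra_{K,j}\bigr)+n2peb_{K,v}+\bigl(\pi(\bar K)-(2+|S|)\bigr)\pi(K). \]
   Context: The Cartesian product $G\,\square\,H$ has vertex set $V(G)\times V(H)$, with $(g,h)\sim(g',h')$ iff ($g=g'$ and $h\sim_H h'$) or ($h=h'$ and $g\sim_G g'$). A configuration on a graph $X$ is a function $c:V(X)\to\mathbb{Z}_{\ge0}$; its support size is the number of vertices with $c>0$. A pebbling move removes two pebbles from a vertex and adds one to an adjacent vertex. $\pi(X)$ (pebbling number) is the least $k$ such that from every configuration of size $k$ on $X$ and every root some sequence of pebbling moves places a pebble on the root. For $1\le s\le |X|$, the 2-pebbling number $\pi_2(X,s)$ is the least number $N$ such that from every configuration on $X$ with $N$ pebbles and support size $s$, for every root, some sequence of pebbling moves places two pebbles on the root. For $K\in\{G,H\}$, $\bar K$ is the other graph; for $j\in V(\bar K)$ the $K$-slice $K_j$ is $\{(i,j):i\in V(G)\}$ if $K=G$ and $\{(j,h):h\in V(H)\}$ if $K=H$ (a copy of $K$). For a configuration $c$ on $G\,\square\,H$: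 $\tilde c_{K,j}=\sum_{u\in K_j}c(u)$; $set_{K,j}=\lfloor\tilde c_{K,j}/\pi(K)\rfloor$; $extra_{K,j}=\tilde c_{K,j}-\pi(K)\,set_{K,j}$; $support_{K,j}$ is the number of vertices of $K_j$ with positive pebble count; $n2peb_{K,j}=\pi_2(K,support_{K,j})$ if $support_{K,j}\ge1$, and $n2peb_{K,j}=2\pi(K)$ if $support_{K,j}=0$.
   Formalization: The 2-pebbling number π_2(X,s) is taken as the least N ≥ s with the stated property; without N ≥ s the minimum would vacuously be 0 for every s ≥ 1 and the inequality would fail. *)

(* Defs.v *)
From HB Require Import structures.
From mathcomp Require Import all_boot.
From mathcomp Require Import boolp.

Set Implicit Arguments.
Unset Strict Implicit.
Unset Printing Implicit Defensive.

Record sgraph := SGraph {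
  vertex :> finType;
  adj : rel vertex;
  adj_sym : symmetric adj;
  adj_irr : irreflexive adj
}.

Definition connected_graph (X : sgraph) : Prop :=
  0 < #|X| /\ forall x y : X, connect (@adj X) x y.

Section CartesianProduct.
Variables G H : sgraph.

Definition cart_adj : rel (G * H) :=
  fun u w => (u.1 == w.1) && adj u.2 w.2 || (u.2 == w.2) && adj u.1 w.1.

Lemma cart_adj_sym : symmetric cart_adj.
Proof.
by move=> u w; rewrite /cart_adj (eq_sym u.1) (eq_sym u.2) (adj_sym u.1)
  (adj_sym u.2).
Qed.

Lemma cart_adj_irr : irreflexive cart_adj.
Proof. by move=> u; rewrite /cart_adj !adj_irr !andbF. Qed.

Definition cart : sgraph := SGraph cart_adj_sym cart_adj_irr.

End CartesianProduct.

Section Pebbling.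
Variable X : sgraph.

Definition config := {ffun X -> nat}.

Definition csize (c : config) : nat := \sum_(x : X) c x.

Definition support_size (c : config) : nat := #|[set x : X | 0 < c x]|.

Definition move (c : config) (u w : X) : config :=
  [ffun x => if x == u then c x - 2 else if x == w then c x + 1 else c x].

Inductive reachable (c : config) : config -> Prop :=
| reachable_refl : reachable c c
| reachable_step c' u w :
    reachable c c' -> adj u w -> 2 <= c' u -> reachable c (move c' u w).

Definition can_place (m : nat) (c : config) (r : X) : Prop :=
  exists2 c' : config, reachable c c' & m <= c' r.

End Pebbling.

(* The value is 0 when no n satisfies P; this does not happen for [pebbling]
   and [pebbling2] below on a connected graph, for 1 <= s <= #|X|. *)
Definition least (P : nat -> Prop) : nat :=
  match pselect (exists n, `[< P n >]) with
  | left exP => ex_minn exP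
  | right _ => 0
  end.

Definition pebbling (X : sgraph) : nat :=
  least (fun k => forall (c : config X) (r : X),
    csize c = k -> can_place 1 c r).

(* A configuration with support size s has at least s pebbles, so without the
   condition s <= N the minimum would vacuously be 0 for every s >= 1. *)
Definition pebbling2 (X : sgraph) (s : nat) : nat :=
  least (fun N => s <= N /\ forall (c : config X) (r : X),
    csize c = N -> support_size c = s -> can_place 2 c r).

Variant side := FactorG | FactorH.

Definition other (K : side) : side :=
  match K with FactorG => FactorH | FactorH => FactorG end.

Section Slices.
Variables G H : sgraph.

Definition factor (K : side) : sgraph :=
  match K with FactorG => G | FactorH => H end.

Definition slice (K : side) : factor (other K) -> {set cart G H} :=
  match K return factor (other K) -> {set cart G H} with
  | FactorG => fun j => [set u : cart G H | u.2 == j]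
  | FactorH => fun j => [set u : cart G H | u.1 == j]
  end.

Variables (c : config (cart G H)) (K : side) (j : factor (other K)).

Definition slice_size : nat := \sum_(u in slice j) c u.

Definition slice_sets : nat := slice_size %/ pebbling (factor K).

Definition slice_extra : nat := slice_size - pebbling (factor K) * slice_sets.

Definition slice_support : nat := #|[set u in slice j | 0 < c u]|.

Definition slice_n2peb : nat :=
  if 1 <= slice_support then pebbling2 (factor K) slice_support
  else 2 * pebbling (factor K).

End Slices.

(* Main.v *)
Require Import Defs.
From mathcomp Require Import all_boot.
From mathcomp Require Import boolp zify.

Set Implicit Arguments.
Unset Strict Implicit.
Unset Printing Implicit Defensive.

(** Write [p] and [q] for the pebbling numbers of [K] and of the other factor,
    and suppose that the inequality fails.  Then the slice over [v] is rich
    enough to send [p - extra_j] pebbles into the slice over every [j] in [S],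
    always moving pairs of pebbles off a vertex that keeps at least one pebble,
    so that the support of the slice does not change.  After that the slice over
    [v] still puts two pebbles on the projection of the root by the 2-pebbling
    number, and [q - (2 + #|S|)] further ones, while each slice over [S] puts one
    there.  These [q] pebbles lie in a single copy of the other factor, hence
    they reach the root. *)

(** * Calculus of pebble counts that moves can guarantee *)

Section Yields.
Variable X : sgraph.
Implicit Types (f g h : X -> nat) (c d : config X).

Definition delta (u : X) : X -> nat := fun x => x == u.

(** Only a lower bound on the final configuration is recorded, so surplus pebbles can be forgotten
    and counts compared pointwise. *)
Definition yields f g : Prop :=
  exists2 c : config X, reachable (finfun f) c & forall x, g x <= c x.

Lemma reachable_trans c c' c'' :
  reachable c c' -> reachable c' c'' -> reachable c c''.
Proof.
move=> cc'; elim=> // d u w _ cd uw du.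
exact: reachable_step.
Qed.

(** The moves are replayed while the pebbles of [d] lie idle. *)
Lemma reachable_frame c c' d : reachable c c' ->
  reachable [ffun x => c x + d x] [ffun x => c' x + d x].
Proof.
elim=> [|e u w _ IH uw eu]; first exact: reachable_refl.
have -> : [ffun x => move e u w x + d x] = move [ffun x => e x + d x] u w.
  by apply/ffunP=> x; rewrite !ffunE; case: eqP => [->|_]; [lia | case: eqP; lia].
by apply: reachable_step; rewrite ?ffunE //; lia.
Qed.

Lemma yieldsW f f' g g' : (forall x, f x <= f' x) -> (forall x, g' x <= g x) ->
  yields f g -> yields f' g'.
Proof.
move=> ff' gg' [c fc gc].
have := reachable_frame [ffun x => f' x - f x] fc.
have -> : [ffun x => finfun f x + [ffun x => f' x - f x] x] = finfun f'.
  by apply/ffunP=> x; rewrite !ffunE subnKC.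
exists [ffun x => c x + [ffun x => f' x - f x] x] => // x.
by rewrite !ffunE; move: (gg' x) (gc x); lia.
Qed.

Lemma yields_refl f : yields f f.
Proof. by exists (finfun f) => [|x]; rewrite ?ffunE //; apply: reachable_refl. Qed.

Lemma yields_trans f g h : yields f g -> yields g h -> yields f h.
Proof.
move=> [c fc gc] /(yieldsW gc (fun=> leqnn _)) [d cd hd].
by exists d => //; apply: reachable_trans fc _; rewrite ffunK in cd.
Qed.

(** The moves from [f] are made while [f'] lies idle, then those from [f'] while [g] does. *)
Lemma yields_add f f' g g' : yields f g -> yields f' g' ->
  yields (fun x => f x + f' x) (fun x => g x + g' x).
Proof.
have frame h h1 h2 : yields h1 h2 ->
    yields (fun x => h1 x + h x) (fun x => h2 x + h x).
  move=> [c h1c h2c]; have := reachable_frame (finfun h) h1c.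
  have -> : [ffun x => finfun h1 x + finfun h x] = [ffun x => h1 x + h x].
    by apply/ffunP=> x; rewrite !ffunE.
  by exists [ffun x => c x + finfun h x] => // x; rewrite !ffunE leq_add2r.
move=> fg f'g'; apply: yields_trans (frame f' _ _ fg) _.
by apply: yieldsW (frame g _ _ f'g') => x; rewrite addnC.
Qed.

Lemma yields_sum (I : finType) (S : {set I}) (F F' : I -> X -> nat) :
  (forall i, i \in S -> yields (F i) (F' i)) ->
  yields (fun x => \sum_(i in S) F i x) (fun x => \sum_(i in S) F' i x).
Proof.
move=> FF'.
have sums (s : seq I) : all (mem S) s ->
    yields (fun x => \sum_(i <- s) F i x) (fun x => \sum_(i <- s) F' i x).
  elim: s => [_|i s IH /= /andP[iS /IH sF]].
    by apply: yieldsW (yields_refl (fun=> 0)) => x; rewrite big_nil.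
  by apply: yieldsW (yields_add (FF' _ iS) sF) => x; rewrite big_cons.
have := sums (enum S); rewrite (introT allP) => [/(_ isT)|i]; last first.
  by rewrite mem_enum.
by apply: yieldsW => x; rewrite big_enum.
Qed.

Lemma yields_scale n f g : yields f g ->
  yields (fun x => n * f x) (fun x => n * g x).
Proof.
move=> fg; elim: n => [|n IH]; first exact: yields_refl.
by apply: yieldsW (yields_add fg IH) => x; rewrite mulSn.
Qed.

Lemma yields_move u w : adj u w -> yields (fun x => 2 * delta u x) (delta w).
Proof.
move=> uw; exists (move [ffun x => 2 * delta u x] u w) => [|x].
  apply: reachable_step => //; first exact: reachable_refl.
  by rewrite ffunE /delta eqxx.
rewrite !ffunE /delta; case: (eqVneq x w) => [->|_]; rewrite ?addn1 //.
by case: eqP uw => // ->; rewrite adj_irr.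
Qed.

Lemma can_placeE m c r : can_place m c r <-> yields c (fun x => m * delta r x).
Proof.
rewrite /yields ffunK; split=> [[d cd md]|[d cd md]]; exists d => //.
  by move=> x; rewrite /delta; case: eqP => [->|_]; rewrite ?muln1 ?muln0.
by have := md r; rewrite /delta eqxx muln1.
Qed.

(** Pebbles are added to [l] one at a time while there is room below [f]. This cuts out the
    subconfigurations of exact size that both pebbling numbers speak of; [l] serves to fix the
    support. *)
Lemma leq_subfunction (l f : X -> nat) n : (forall x, l x <= f x) ->
  \sum_x l x <= n <= \sum_x f x ->
  exists g, [/\ forall x, l x <= g x, forall x, g x <= f x & \sum_x g x = n].
Proof.
move=> lf /andP[ln nf].
elim: n ln nf => [ln _|n IH ln nf].
  by exists l; split=> //; apply/eqP; rewrite -leqn0.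
move: ln; rewrite leq_eqVlt => /orP[/eqP <-|ln]; first by exists l.
have [g [lg gf gn]] := IH ln (ltnW nf).
have [x gx|ge] := pickP (fun x => g x < f x).
  exists (fun y => g y + delta x y); split=> [y|y|].
  - exact: leq_trans (lg y) (leq_addr _ _).
  - by rewrite /delta; case: eqP => [->|_]; rewrite ?addn1 ?addn0.
  - rewrite big_split gn /= (bigD1 x) //= /delta eqxx big1 ?addn1 // => y.
    by move/negbTE->.
suff: \sum_x f x <= n by lia.
by rewrite -gn; apply: leq_sum => x _; rewrite leqNgt ge.
Qed.

(** Shares are taken greedily, each from what the earlier ones leave of [f]. *)
Lemma leq_subfunction_family (I : finType) (S : {set I}) (k : I -> nat) f :
  \sum_(i in S) k i <= \sum_x f x ->
  exists m : I -> X -> nat, (forall i, i \in S -> \sum_x m i x = k i) /\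
    (forall x, \sum_(i in S) m i x <= f x).
Proof.
rewrite -big_enum /=.
suff family (s : seq I) : uniq s -> \sum_(i <- s) k i <= \sum_x f x ->
    exists m : I -> X -> nat, (forall i, i \in s -> \sum_x m i x = k i) /\
      (forall x, \sum_(i <- s) m i x <= f x).
  case/(family _ (enum_uniq S)) => m [mk mf]; exists m; split=> [i iS|x].
    by apply: mk; rewrite mem_enum.
  by rewrite -big_enum.
elim: s f => [|i s IH] f /=.
  by exists (fun _ _ => 0); split=> // x; rewrite big_nil.
case/andP=> is_ us; rewrite big_cons => kf.
have [||g [_ gf gk]] := @leq_subfunction (fun=> 0) f (k i) => //.
  by rewrite big1 //=; lia.
have fg : \sum_x (f x - g x) = \sum_x f x - \sum_x g x.
  by rewrite sumnB.
have [|m [mk mf]] := IH (fun x => f x - g x) us; first by rewrite fg gk; lia.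
have ne j : j \in s -> (j == i) = false.
  by move=> js; apply: contraNF is_ => /eqP <-.
exists (fun j => if j == i then g else m j); split=> [j|x].
  by rewrite inE; case: eqP => [-> _|_ /=] //; apply: mk.
rewrite big_cons eqxx.
have -> : \sum_(j <- s) (if j == i then g else m j) x = \sum_(j <- s) m j x.
  by apply: eq_big_seq => j /ne ->.
by move: (mf x) (gf x); lia.
Qed.

End Yields.

(** * Transport of pebble counts along graph homomorphisms *)

Section Push.
Variables (X Y : sgraph) (e : X -> Y).

Definition push (f : X -> nat) : Y -> nat := fun y => \sum_(x | e x == y) f x.

Lemma pushD f g y : push (fun x => f x + g x) y = push f y + push g y.
Proof. exact: big_split. Qed.

Lemma push_sum (I : finType) (S : {set I}) (F : I -> X -> nat) y :
  push (fun x => \sum_(i in S) F i x) y = \sum_(i in S) push (F i) y.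
Proof. exact: exchange_big. Qed.

Lemma pushZ n f y : push (fun x => n * f x) y = n * push f y.
Proof. by rewrite /push big_distrr. Qed.

Lemma leq_push f g : (forall x, f x <= g x) -> forall y, push f y <= push g y.
Proof. by move=> fg y; apply: leq_sum. Qed.

Lemma push_delta u y : push (delta u) y = delta (e u) y.
Proof.
rewrite /push /delta big_mkcond (bigD1 u) //= eqxx big1 => [|x /negbTE->].
  by rewrite addn0 eq_sym; case: eqP.
by case: ifP.
Qed.

Hypothesis e_adj : forall x x', adj x x' -> adj (e x) (e x').

Lemma yields_push f g : yields f g -> yields (push f) (push g).
Proof.
move=> [c fc gc]; apply: (@yieldsW _ (push f) _ (push c)) (leq_push gc) _ => //.
apply: (@yieldsW _ (push (finfun f)) _ (push c)) => // [y|].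
  by apply: leq_sum => x _; rewrite ffunE.
elim: fc => [|d u w _ IH uw du]; first exact: yields_refl.
apply: yields_trans IH _.
(* [rest] collects the pebbles that take no part in the move from [u] to [w]. *)
pose rest x := d x - 2 * delta u x.
apply: (yieldsW _ _ (yields_add (yields_refl (push rest)) (yields_move (e_adj uw)))).
  move=> y; rewrite -push_delta -pushZ -pushD; apply: leq_push => x.
  by rewrite /rest /delta; case: eqP => [->|_]; lia.
move=> y; rewrite -push_delta -pushD; apply: leq_push => x.
by rewrite ffunE /rest /delta; case: eqP => [->|_]; [lia | case: eqP; lia].
Qed.

End Push.

Lemma leastP (P : nat -> Prop) : (exists n, P n) -> P (least P).
Proof.
move=> [n Pn]; rewrite /least; case: pselect => [exP|[]].
  by case: ex_minnP => m /asboolP.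
by exists n; apply/asboolP.
Qed.

(** * Using the pebbling and 2-pebbling numbers of a connected graph *)

Section PebblingNumbers.
Variable X : sgraph.
Hypothesis X_connected : connected_graph X.
Implicit Types (f : X -> nat) (r : X).

Lemma yields_path x (p : seq X) m : path (@adj X) x p ->
  yields (fun y => 2 ^ size p * m * delta x y) (fun y => m * delta (last x p) y).
Proof.
elim: p x => [|z p IH] x /=; first by rewrite mul1n => _; apply: yields_refl.
case/andP=> xz /IH zp; apply: yields_trans zp.
apply: yieldsW (yields_scale (2 ^ size p * m) (yields_move xz)) => // y.
by rewrite expnS; lia.
Qed.

(** By pigeonhole some vertex holds [2 ^ #|X| * m] pebbles, and a simple path to [r] has fewer than
    [#|X|] edges, each costing a factor 2. This crude bound shows that both minima exist. *)
Lemma yields_large f r m : #|X| * (2 ^ #|X| * m) <= \sum_x f x ->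
  yields f (fun x => m * delta r x).
Proof.
case: m => [|m] large.
  exact: (yieldsW (f := f) (fun=> leqnn _) _ (yields_refl f)).
have [X_gt0 X_conn] := X_connected.
have [x fx|small] := pickP (fun x => 2 ^ #|X| * m.+1 <= f x).
  have /connectP[p0 p0P ->] := X_conn x r.
  case/shortenP: p0P => p pP p_uniq _.
  apply: yieldsW (yields_path m.+1 pP) => // y.
  rewrite /delta; case: eqP => [->|_]; rewrite ?muln0 // muln1.
  apply: leq_trans fx; rewrite leq_mul2r /= leq_exp2l //.
  by apply: ltnW; have /card_uniqP := p_uniq; rewrite /= => <-; apply: max_card.
suff: \sum_x f x < #|X| * (2 ^ #|X| * m.+1) by lia.
rewrite -sum_nat_const.
have /card_gt0P[x0 _] := X_gt0.
rewrite (bigD1 x0) //= [ltnRHS](bigD1 x0) //= -addSn leq_add //.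
  by rewrite ltnNge small.
by apply: leq_sum => x _; apply: ltnW; rewrite ltnNge small.
Qed.

Lemma yields_pebbling f r : pebbling X <= \sum_x f x -> yields f (delta r).
Proof.
have solvable : forall (c : config X) r0, csize c = pebbling X -> can_place 1 c r0.
  apply: (@leastP (fun k => forall (c : config X) r0, csize c = k -> can_place 1 c r0)).
  exists (#|X| * (2 ^ #|X| * 1)) => c r0 ck.
  by apply/can_placeE/yields_large; rewrite -ck.
move=> pf; have [||g [_ gf gp]] := @leq_subfunction X (fun=> 0) f (pebbling X) => //.
  by rewrite big1.
have /can_placeE : can_place 1 (finfun g : config X) r.
  by apply: solvable; rewrite -gp; apply: eq_bigr => x _; rewrite ffunE.
by apply: yieldsW => x; rewrite ?ffunE ?mul1n.
Qed.

Lemma yields_pebbling_mul k f r : k * pebbling X <= \sum_x f x ->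
  yields f (fun x => k * delta r x).
Proof.
elim: k f => [|k IH] f kf.
  exact: (yieldsW (f := f) (fun=> leqnn _) _ (yields_refl f)).
have [||g [_ gf gp]] := @leq_subfunction X (fun=> 0) f (pebbling X) => //.
  by rewrite big1 //=; lia.
have fg : \sum_x (f x - g x) = \sum_x f x - \sum_x g x by rewrite sumnB.
have g1 : yields g (delta r) by apply: yields_pebbling; rewrite gp.
have gk : yields (fun x => f x - g x) (fun x => k * delta r x).
  by apply: IH; rewrite fg gp; lia.
by apply: yieldsW (yields_add g1 gk) => x; rewrite ?subnKC ?mulSn.
Qed.

(** One pebble on every vertex except the root allows no move at all. *)
Lemma card_leq_pebbling : #|X| <= pebbling X.
Proof.
have [/card_gt0P[r _] _] := X_connected.
rewrite leqNgt; apply/negP => small.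
have [||g [_ gf gp]] := @leq_subfunction X (fun=> 0) (fun x => x != r) (pebbling X) => //.
  rewrite big1 //= -(leq_add2l 1) add1n (leq_trans small) // -sum1_card.
  by rewrite (bigD1 r) //= leq_add2l big_mkcond leq_sum // => x _; case: ifP.
have [c gc] : yields g (delta r) by apply: yields_pebbling; rewrite gp.
move=> /(_ r); rewrite /delta eqxx.
have -> : c = finfun g.
  elim: gc => // d u w _ -> _; rewrite ffunE; have := gf u; case: (u != r) => /=; lia.
by rewrite ffunE; have := gf r; rewrite eqxx /=; lia.
Qed.

Lemma pebbling2P s : s <= #|X| -> s <= pebbling2 X s /\
  forall (c : config X) r, csize c = pebbling2 X s -> support_size c = s ->
  can_place 2 c r.
Proof.
move=> sX; apply: (@leastP (fun N => s <= N /\ forall (c : config X) r,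
  csize c = N -> support_size c = s -> can_place 2 c r)).
exists (#|X| * (2 ^ #|X| * 2)); split=> [|c r cN _].
  by apply: leq_trans sX _; apply: leq_pmulr; rewrite muln_gt0 expn_gt0.
by apply/can_placeE/yields_large; rewrite -cN.
Qed.

Lemma sum_support f : \sum_x (0 < f x) = #|[set x | 0 < f x]|.
Proof. by rewrite -sum1dep_card [RHS]big_mkcond; apply: eq_bigr => x _; case: ltnP. Qed.

Lemma yields_pebbling2 k f r :
  pebbling2 X #|[set x | 0 < f x]| + k * pebbling X <= \sum_x f x ->
  yields f (fun x => (2 + k) * delta r x).
Proof.
set s := #|_| => kf.
have [sN solvable] := pebbling2P (max_card _ : s <= #|X|).
(* The lower bound is the indicator of the support of [f], so [g] has the same support size [s]. The
   pebbles of [f] outside [g] provide the other [k]. *)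
have [||g [lg gf gp]] := @leq_subfunction X (fun x => 0 < f x) f (pebbling2 X s).
- by move=> x; case: (f x).
- by rewrite sum_support -/s sN /=; lia.
have fg : \sum_x (f x - g x) = \sum_x f x - \sum_x g x by rewrite sumnB.
have /can_placeE g2 : can_place 2 (finfun g : config X) r.
  apply: solvable; first by rewrite -gp; apply: eq_bigr => x _; rewrite ffunE.
  apply: eq_card => x; rewrite !inE ffunE.
  by have := lg x; have := gf x; case: (f x) => [|n]; case: (g x).
have gk := @yields_pebbling_mul k (fun x => f x - g x) r.
apply: yieldsW (yields_add g2 (gk _)) => [x|x|]; rewrite ?ffunE ?subnKC ?mulnDl //.
by rewrite fg gp; lia.
Qed.

End PebblingNumbers.

(** * Slices of a product, with either factor in the role of [A] *)

Section Product.
Variables (A B Z : sgraph) (e : A -> B -> Z) (pA : Z -> A) (pB : Z -> B).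
Hypotheses (A_connected : connected_graph A) (B_connected : connected_graph B).
Hypothesis e_adjA : forall b a a', adj a a' -> adj (e a b) (e a' b).
Hypothesis e_adjB : forall a b b', adj b b' -> adj (e a b) (e a b').
Hypotheses (pAK : forall a b, pA (e a b) = a) (pBK : forall a b, pB (e a b) = b).

Lemma yields_across b b' (f : A -> nat) : adj b b' ->
  yields (push (e^~ b) (fun a => 2 * f a)) (push (e^~ b') f).
Proof.
move=> bb'.
have moved : yields (fun z => \sum_(a in [set: A]) f a * (2 * delta (e a b) z))
    (fun z => \sum_(a in [set: A]) f a * delta (e a b') z).
  by apply: yields_sum => a _; apply/yields_scale/yields_move/e_adjB.
have pushE b0 n z : push (e^~ b0) (fun a => n * f a) z
    = \sum_(a in [set: A]) f a * (n * delta (e a b0) z).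
  rewrite /push big_mkcond; apply: eq_big => [a|a _]; first by rewrite inE.
  by rewrite /delta eq_sym; case: eqP => _; lia.
apply: yieldsW moved => z; first by rewrite pushE.
rewrite -[leqLHS]mul1n -pushZ pushE; apply: leq_sum => a _; lia.
Qed.

(** Slices over distinct vertices are disjoint: [z] can only lie over [pB z], and there at a single
    [a]. *)
Lemma slices_leq (c : Z -> nat) (T : {set B}) z :
  \sum_(b in T) push (e^~ b) (fun a => c (e a b)) z <= c z.
Proof.
have [pbT|pbT] := boolP (pB z \in T); last first.
  rewrite big1 // => b bT; rewrite /push big_pred0 // => a.
  by apply: contraNF pbT => /eqP <-; rewrite pBK.
rewrite (bigD1 (pB z)) //= [X in _ + X]big1 ?addn0 => [|b /andP[_ bz]]; last first.
  rewrite /push big_pred0 // => a.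
  by apply: contraNF bz => /eqP <-; rewrite pBK.
rewrite /push.
have [a ez|none] := pickP (fun a => e a (pB z) == z); last by rewrite big_pred0.
rewrite (big_pred1 a) ?(eqP ez) // => a' /=.
apply/idP/eqP => [/eqP e'z|->//].
by rewrite -(pAK a' (pB z)) e'z -(eqP ez) pAK.
Qed.

(** Here [A] stands for the factor [K], and [k j] is the number of pebbles to be sent into the slice
    over [j]. *)
Lemma yields_slices (c : Z -> nat) (v : B) (S : {set B}) (k : B -> nat) rA rB :
  S \subset [set w | adj w v] -> #|S| + 3 <= pebbling B ->
  (forall j, j \in S -> pebbling A <= k j + \sum_a c (e a j)) ->
  2 * (\sum_(j in S) k j) + pebbling2 A #|[set a | 0 < c (e a v)]|
    + (pebbling B - (2 + #|S|)) * pebbling A <= \sum_a c (e a v) ->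
  yields c (delta (e rA rB)).
Proof.
move=> /subsetP Sv qS pk big_v.
set s := #|_| in big_v; pose cv a := c (e a v).
have vS : v \notin S by apply/negP => /Sv; rewrite inE adj_irr.
have [s_le _] := pebbling2P A_connected (max_card _ : s <= #|A|).
have As : s <= pebbling A := leq_trans (max_card _) (card_leq_pebbling A_connected).
(* The number of pairs a vertex can give away while keeping one pebble. *)
pose half a := (cv a).-1./2.
have cv_half a : cv a <= 2 * half a + 2 * (0 < cv a).
  by rewrite /half; case: (cv a) => // n; have := odd_double_half n; lia.
(* There are enough pairs: by [cv_half] at most [2 * s] pebbles stay unpaired. One [s] is paid for
   by [pebbling2 A s], the other by the last term of [big_v], whose factor [pebbling B - (2 + #|S|)]
   is at least 1. *)
have [|m [mk mhalf]] := @leq_subfunction_family A _ S k half.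
  have : \sum_a cv a <= \sum_a (2 * half a + 2 * (0 < cv a)) by apply: leq_sum.
  rewrite big_split /= -!big_distrr /= sum_support -/s.
  have : pebbling A <= (pebbling B - (2 + #|S|)) * pebbling A by apply: leq_pmull; lia.
  rewrite /cv; lia.
pose give a := \sum_(j in S) m j a.
pose keep a := cv a - 2 * give a.
have cvE a : cv a = keep a + 2 * give a.
  rewrite /keep subnK //; have := mhalf a; rewrite -/(give a) /half.
  by have := odd_double_half (cv a).-1; lia.
(* An occupied vertex gives at most [2 * half a], which is less than [cv a]. The 2-pebbling number
   for [s] thus still applies to [keep]. *)
have sup_keep : #|[set a | 0 < keep a]| = s.
  apply: eq_card => a'; rewrite !inE /keep -/(cv a').
  have := mhalf a'; rewrite -/(give a') /half.
  by have := odd_double_half (cv a').-1; lia.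
have sum_give : \sum_a give a = \sum_(j in S) k j.
  by rewrite exchange_big /=; apply: eq_bigr => j /mk.
have keep_v : yields (push (e^~ v) keep)
    (fun z => (pebbling B - #|S|) * delta (e rA v) z).
  have : yields keep (fun a' => (2 + (pebbling B - (2 + #|S|))) * delta rA a').
    apply: yields_pebbling2 => //; rewrite sup_keep.
    have : \sum_a cv a = \sum_a keep a + 2 * \sum_a give a.
      by rewrite big_distrr -big_split; apply: eq_bigr => a' _; apply: cvE.
    by rewrite sum_give /cv; lia.
  move/(yields_push (e_adjA v)); apply: yieldsW => // z.
  by rewrite pushZ push_delta; apply: leq_mul => //; lia.
(* The pairs [m j] cross the edge from [v] to [j] and arrive as [k j] pebbles, which fill that slice
   up to [pebbling A]. *)
have slice_j j : j \in S -> yields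
    (fun z => push (e^~ v) (fun a => 2 * m j a) z + push (e^~ j) (fun a => c (e a j)) z)
    (delta (e rA j)).
  move=> jS; have vj : adj v j by rewrite adj_sym; have := Sv _ jS; rewrite inE.
  apply: yields_trans (yields_add (yields_across (m j) vj) (yields_refl _)) _.
  have mj : yields (fun a => m j a + c (e a j)) (delta rA).
    by apply: yields_pebbling; rewrite // big_split /= mk // pk.
  by apply: yieldsW (yields_push (e_adjA j) mj) => z; rewrite ?pushD ?push_delta.
(* These are exactly [pebbling B] pebbles, to be placed in the copy of [B] over [rA]. *)
have in_copy : yields (fun b' => (pebbling B - #|S|) * delta v b' + \sum_(j in S) delta j b')
    (delta rB).
  apply: yields_pebbling => //; rewrite big_split /= -big_distrr /= exchange_big /=.
  have sum_delta b' : \sum_b0 delta b' b0 = 1.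
    by rewrite (bigD1 b') //= /delta eqxx big1 // => ? /negbTE->.
  by rewrite sum_delta (eq_bigr (fun=> 1)) // sum1_card; lia.
apply: yields_trans (yieldsW _ _ (yields_push (e_adjB rA) in_copy)); last first.
- by move=> z; rewrite push_delta.
- move=> z; exact: leqnn.
apply: yieldsW (yields_add keep_v (yields_sum slice_j)) => z; last first.
  rewrite pushD pushZ push_delta push_sum leq_add2l.
  by apply: leq_sum => j _; rewrite push_delta.
(* Over [v], [keep] and the given pairs recombine to [cv]; with the slices over [S] they fit
   disjointly inside [c]. *)
rewrite big_split /= addnA -push_sum -pushD.
apply: leq_trans (slices_leq c (v |: S) z); rewrite big_setU1 //= leq_add2r.
by apply: leq_push => a'; rewrite -/(cv a') cvE -big_distrr.
Qed.

End Product.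

(** * Slices of [cart G H] in coordinates, and the inequality *)

Lemma sum_snd_fiber (G H : finType) (F : G * H -> nat) h :
  \sum_(u | u.2 == h) F u = \sum_g F (g, h).
Proof.
rewrite (reindex_onto (fun g => (g, h)) fst) /= => [|[g h'] /eqP <-] //.
by apply: eq_bigl => g; rewrite !eqxx.
Qed.

Lemma sum_fst_fiber (G H : finType) (F : G * H -> nat) g :
  \sum_(u | u.1 == g) F u = \sum_h F (g, h).
Proof.
rewrite (reindex_onto (fun h => (g, h)) snd) /= => [|[g' h] /eqP <-] //.
by apply: eq_bigl => h; rewrite !eqxx.
Qed.

Theorem theorem5 (G H : sgraph) (r : cart G H) (K : side)
    (v : factor G H (other K)) (S : {set factor G H (other K)})
    (c : config (cart G H))
    (G_connected : connected_graph G)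
    (H_connected : connected_graph H)
    (S_neighbours : S \subset [set w | adj w v])
    (S_nonempty : 1 <= #|S|)
    (S_small : #|S| + 3 <= pebbling (factor G H (other K)))
    (c_unsolvable : ~ can_place 1 c r) :
  slice_size c v + 1 <=
    2 * (\sum_(j in S) (pebbling (factor G H K) - slice_extra c j))
    + slice_n2peb c v
    + (pebbling (factor G H (other K)) - (2 + #|S|)) * pebbling (factor G H K).
Proof.
have Kp_gt0 : 0 < pebbling (factor G H K).
  case: (G_connected) (H_connected) => G_gt0 _ [H_gt0 _].
  by case: (K); apply: leq_trans (card_leq_pebbling _).
(* If the slice over [v] is empty, the left side is 1 and the value [2 * pebbling] of [slice_n2peb]
   already covers it. *)
have [s0|s_gt0] := posnP (slice_support c v).
  have -> : slice_size c v = 0.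
    apply: big1 => u uv; apply/eqP; rewrite -leqn0 leqNgt; apply/negP => cu.
    by move/eqP: s0; rewrite cards_eq0 => /eqP/setP/(_ u); rewrite !inE uv cu.
  by rewrite /slice_n2peb s0 /= addn_gt0 addn_gt0 !muln_gt0 Kp_gt0 orbT.
rewrite leqNgt /slice_n2peb s_gt0; apply/negP => big_v; apply: c_unsolvable.
apply/can_placeE.
(* Hence adding [pebbling - slice_extra] pebbles brings the slice to at least [pebbling]. *)
have extra_le K0 (j : factor G H (other K0)) : slice_extra c j <= slice_size c j.
  exact: leq_subr.
suff: yields c (delta r) by apply: yieldsW => // x; rewrite mul1n.
case: K v S S_neighbours S_nonempty S_small Kp_gt0 s_gt0 big_v.
- move=> /= v0 S0 Sv _ Ssmall _ _ big_v.
  rewrite (surjective_pairing r).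
  have sizeE j : slice_size (K := FactorG) c j = \sum_g c (g, j).
    by rewrite -(sum_snd_fiber c); apply: eq_bigl => u; rewrite inE.
  apply: (@yields_slices G H (cart G H) (fun g h => (g, h)) fst snd _ _ _ _ _ _
    c v0 S0 (fun j => pebbling G - slice_extra (K := FactorG) c j)) => //.
  + by move=> h g g' gg'; rewrite /adj /= /cart_adj /= eqxx gg' orbT.
  + by move=> g h h' hh'; rewrite /adj /= /cart_adj /= eqxx hh'.
  + by move=> j _; rewrite -sizeE; have := extra_le FactorG j; lia.
  + rewrite -sizeE.
    have <- : slice_support (K := FactorG) c v0 = #|[set g | 0 < c (g, v0)]|.
      rewrite -sum_support -(sum_snd_fiber (fun u => 0 < c u : nat)) /slice_support.
      rewrite -sum1dep_card big_mkcondr /=.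
      by apply: eq_big => [u|u _]; rewrite ?inE //; case: (0 < c u).
    by move: big_v; lia.
- move=> /= v0 S0 Sv _ Ssmall _ _ big_v.
  rewrite (surjective_pairing r).
  have sizeE j : slice_size (K := FactorH) c j = \sum_h c (j, h).
    by rewrite -(sum_fst_fiber c); apply: eq_bigl => u; rewrite inE.
  (* The same argument with the factors exchanged: the pairing swaps its arguments and the
     projections trade places. *)
  apply: (@yields_slices H G (cart G H) (fun h g => (g, h)) snd fst _ _ _ _ _ _
    c v0 S0 (fun j => pebbling H - slice_extra (K := FactorH) c j)) => //.
  + by move=> g h h' hh'; rewrite /adj /= /cart_adj /= eqxx hh'.
  + by move=> h g g' gg'; rewrite /adj /= /cart_adj /= eqxx gg' orbT.
  + by move=> j _; rewrite -sizeE; have := extra_le FactorH j; lia.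
  + rewrite -sizeE.
    have <- : slice_support (K := FactorH) c v0 = #|[set h | 0 < c (v0, h)]|.
      rewrite -sum_support -(sum_fst_fiber (fun u => 0 < c u : nat)) /slice_support.
      rewrite -sum1dep_card big_mkcondr /=.
      by apply: eq_big => [u|u _]; rewrite ?inE //; case: (0 < c u).
    by move: big_v; lia.
Qed.
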